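(* Let $0<q<1$, $p=-q$, and let $a,b,c,d$ be nonzero complex parameters such that none of $-ab$, $ac$, $ad$, $abcd$ belongs to $\{p^{-k}:k=0,1,2,\ldots\}$. Let $Q_n(x)=Q_n(x;a,b,c,d\,|\,q)$, $n\geq 0$, be the polynomials in $x=z-z^{-1}$ defined by $Q_{-1}(x)=0$, $Q_0(x)=1$ and $$(z-z^{-1})Q_n(x)=A_nQ_{n+1}(x)+[a-a^{-1}-A_n-C_n]Q_n(x)+C_nQ_{n-1}(x),$$ where $$A_n=-\frac{(1+abp^n)(1-acp^n)(1-adp^n)(1-abcdp^{n-1})}{a(1-abcdp^{2n-1})(1-abcdp^{2n})},$$ $$C_n=\frac{a(1-p^n)(1-bcp^{n-1})(1-bdp^{n-1})(1+cdp^{n-1})}{(1-abcdp^{2n-2})(1-abcdp^{2n-1})}.$$ Then for all $n\geq0$, $$Q_n(x;a,b,c,d\,|\,q)={}_4\varphi_3\left({p^{-n},\ abcdp^{n-1},\ -az,\ az^{-1}\atop -ab,\ ac,\ ad};p,p\right),$$ and $Q_n$ satisfies the eigenvalue equation $$\mathcal{D}_zQ_n(x;a,b,c,d\,|\,q)=\left[p^{-n}(1-p^n)(1-abcdp^{n-1})\right]Q_n(x;a,b,c,d\,|\,q),$$ where $$\mathcal{D}_z=B(z)(T_q\mathcal{I}_z-1)+B(-z^{-1})(T_q^{-1}\mathcal{I}_z-1),\qquad B(z)=\frac{(1+az)(1+bz)(1-cz)(1-dz)}{(1+z^2)(1-qz^2)}.$$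
   Context: For $n=0$ one takes $C_0=0$ and the common factor $1-abcdp^{-1}$ in $A_0$ is cancelled, i.e. $A_0=-\frac{(1+ab)(1-ac)(1-ad)}{a(1-abcd)}$. The operators act on functions of $z$ by $T_q^{\pm1}f(z)=f(q^{\pm1}z)$ and $\mathcal{I}_zf(z)=f(z^{-1})$, so $T_q^{\pm 1}\mathcal{I}_zf(z)=f(q^{\mp1}z^{-1})$; a polynomial in $x$ is viewed as a function of $z$ via $x=z-z^{-1}$, and the eigenvalue equation is an identity of rational functions of $z$. $(a;p)_k=\prod_{j=1}^{k}(1-p^{j-1}a)$, $(a_1,\ldots,a_r;p)_k=\prod_i(a_i;p)_k$, and $${}_4\varphi_3\left({a_1,a_2,a_3,a_4\atop b_1,b_2,b_3};p,p\right)=\sum_{k\geq0}\frac{(a_1,a_2,a_3,a_4;p)_k}{(b_1,b_2,b_3;p)_k}\frac{p^k}{(p;p)_k}.$$ *)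

(* Defs.v *)
From HB Require Import structures.
From mathcomp Require Import all_boot all_order all_algebra.
From mathcomp Require Import all_classical all_reals all_analysis.

Set Implicit Arguments.
Unset Strict Implicit.
Unset Printing Implicit Defensive.

Import Order.TTheory GRing.Theory Num.Theory.
Import numFieldNormedType.Exports.

Local Open Scope classical_set_scope.
Local Open Scope ring_scope.

Section BasicHypergeometric.
Variable K : numClosedFieldType.
Implicit Types (a p t : K) (k : nat).

Definition qpoch a p k : K := \prod_(1 <= j < k.+1) (1 - p ^+ j.-1 * a).

Definition phi43_term (a1 a2 a3 a4 b1 b2 b3 : K) p t k : K :=
  (qpoch a1 p k * qpoch a2 p k * qpoch a3 p k * qpoch a4 p k) /
  (qpoch b1 p k * qpoch b2 p k * qpoch b3 p k) * (t ^+ k / qpoch p p k).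

(* The sum over all k >= 0, as the limit of the partial sums in the usual
   topology of K; when a1 = p ^- n the terms with k > n vanish, so the
   partial sums are eventually constant. *)
Definition phi43 (a1 a2 a3 a4 b1 b2 b3 : K) p t : K :=
  limn (series (phi43_term a1 a2 a3 a4 b1 b2 b3 p t)).

End BasicHypergeometric.

Section RecurrenceCoefficients.
Variable K : fieldType.
Variables (p a b c d : K).

(* At n = 0 the factor 1 - abcd p^-1 common to numerator and denominator is
   cancelled: abcd = p is not excluded, and division by 0 would yield 0. *)
Definition recA (n : nat) : K :=
  if n == 0%N then
    - ((1 + a * b) * (1 - a * c) * (1 - a * d)) / (a * (1 - a * b * c * d))
  else
    - ((1 + a * b * p ^+ n) * (1 - a * c * p ^+ n) * (1 - a * d * p ^+ n)
       * (1 - a * b * c * d * p ^ (n%:Z - 1))) /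
      (a * (1 - a * b * c * d * p ^ (2 * n%:Z - 1))
         * (1 - a * b * c * d * p ^ (2 * n%:Z))).

Definition recC (n : nat) : K :=
  if n == 0%N then 0
  else
    (a * (1 - p ^+ n) * (1 - b * c * p ^ (n%:Z - 1))
       * (1 - b * d * p ^ (n%:Z - 1)) * (1 + c * d * p ^ (n%:Z - 1))) /
    ((1 - a * b * c * d * p ^ (2 * n%:Z - 2))
       * (1 - a * b * c * d * p ^ (2 * n%:Z - 1))).

End RecurrenceCoefficients.

Section Operators.
Variable K : fieldType.
Implicit Types (q z : K) (f : K -> K).

Definition shiftT q f : K -> K := fun z => f (q * z).

Definition invI f : K -> K := fun z => f z^-1.

(* A polynomial in x = z - z^-1, viewed as a function of z. *)
Definition fun_of_x (P : {poly K}) : K -> K :=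
  fun z => P.[z - z^-1].

Definition opB q (a b c d : K) z : K :=
  ((1 + a * z) * (1 + b * z) * (1 - c * z) * (1 - d * z)) /
  ((1 + z ^+ 2) * (1 - q * z ^+ 2)).

Definition opD q (a b c d : K) f : K -> K := fun z =>
  opB q a b c d z * (shiftT q (invI f) z - f z)
  + opB q a b c d (- z^-1) * (shiftT q^-1 (invI f) z - f z).

(* z is neither 0 nor a pole of one of the coefficients B(z) and B(-z^-1) of
   the operator; an identity between rational functions built from these
   coefficients and from Laurent polynomials in z is an identity of values at
   all such z. *)
Definition regular_point q z : Prop :=
  [/\ z != 0, (1 + z ^+ 2) * (1 - q * z ^+ 2) != 0
    & (1 + (- z^-1) ^+ 2) * (1 - q * (- z^-1) ^+ 2) != 0].

End Operators.

(* Main.v *)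
Require Import Defs.
From HB Require Import structures.
From mathcomp Require Import all_boot all_order all_algebra.
From mathcomp Require Import complex.
From mathcomp Require Import all_classical all_reals all_analysis.
From mathcomp Require Import ring zify.

Set Implicit Arguments.
Unset Strict Implicit.
Unset Printing Implicit Defensive.

Import Order.TTheory GRing.Theory Num.Theory.
Import numFieldNormedType.Exports.

Local Open Scope ring_scope.

(** Expand in the basis e_k = (-az, a/z; p)_k, which is a polynomial of degree k
    in x = z - 1/z because (1 + a z p^j)(1 - a p^j / z) = 1 - a^2 p^(2j) + a p^j x.
    Multiplication by x and the operator D are both two-term on this basis:
    x e_k is a combination of e_(k+1) and e_k, and D e_k one of e_k and e_(k-1)
    whose e_k-coefficient is the eigenvalue of index k.
    Comparing coefficients of e_k turns the recurrence into a contiguous relation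
    between hypergeometric terms, and the eigenvalue equation into the term
    ratio of the 4phi3 series; in both cases the difference of the two sides,
    summed over k, telescopes to a boundary term that vanishes. *)

(** * Pochhammer symbols in base [p] *)

Section Qpoch.
Variables (K : numClosedFieldType) (p : K).

Lemma qpoch0 (a : K) : qpoch a p 0 = 1.
Proof. by rewrite /qpoch big_geq. Qed.

Lemma qpochS (a : K) k : qpoch a p k.+1 = qpoch a p k * (1 - p ^+ k * a).
Proof. by rewrite /qpoch big_nat_recr. Qed.

Lemma qpochSl (a : K) k : qpoch a p k.+1 = (1 - a) * qpoch (p * a) p k.
Proof.
elim: k => [|k IH]; first by rewrite qpochS !qpoch0 expr0 !mul1r mulr1.
by rewrite qpochS IH [in RHS]qpochS mulrA exprSr mulrA.
Qed.

Lemma reg_neq0 (x : K) (k : nat) :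
  p != 0 -> (forall j : nat, x != p ^- j) -> 1 - p ^+ k * x != 0.
Proof.
move=> p0 H; rewrite subr_eq0; apply: contra (H k) => /eqP e.
apply/eqP; apply: (mulfI (expf_neq0 k p0)).
by rewrite -e mulfV // expf_neq0.
Qed.

Lemma qpoch_neq0 (x : K) k :
  p != 0 -> (forall j : nat, x != p ^- j) -> qpoch x p k != 0.
Proof.
move=> p0 H; elim: k => [|k IH]; first by rewrite qpoch0 oner_neq0.
by rewrite qpochS mulf_neq0 // reg_neq0.
Qed.

Lemma qpoch_vanish n k : p != 0 -> (n < k)%N -> qpoch (p ^- n) p k = 0.
Proof.
move=> p0; elim: k => // k IH; rewrite ltnS leq_eqVlt qpochS => /orP[/eqP <-|/IH ->].
  by rewrite mulfV ?subrr ?mulr0 // expf_neq0.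
by rewrite mul0r.
Qed.

End Qpoch.

Lemma limn_series_finite (K : numFieldType) (u : nat -> K) (n : nat) :
  (forall k, (n < k)%N -> u k = 0) ->
  limn (series u) = \sum_(k < n.+1) u k.
Proof.
move=> u0; apply: lim_near_cst; first exact: norm_hausdorff.
exists n.+1 => // m /= nm; rewrite /series /= (big_cat_nat (n := n.+1)) //= [X in _ + X]big1_seq.
  by rewrite addr0 big_mkord.
by move=> k /=; rewrite mem_index_iota => /andP[nk _]; rewrite u0.
Qed.

(** * The polynomials e_k and the terminating 4phi3 expanded in them *)

Section Expansion.
Variables (K : numClosedFieldType) (p a b c d : K).
Hypothesis p_neq0 : p != 0.
Hypothesis p_pow : forall k : nat, 1 - p ^+ k.+1 != 0.
Hypothesis a_neq0 : a != 0.
Hypothesis ab_reg : forall k : nat, - (a * b) != p ^- k.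
Hypothesis ac_reg : forall k : nat, a * c != p ^- k.
Hypothesis ad_reg : forall k : nat, a * d != p ^- k.
Hypothesis abcd_reg : forall k : nat, a * b * c * d != p ^- k.

Definition awbasis k : {poly K} :=
  \prod_(j < k) ((1 - (a * p ^+ j) ^+ 2)%:P + (a * p ^+ j) *: 'X).

Definition awcoef n k : K :=
  (qpoch (p ^- n) p k * qpoch (a * b * c * d * p ^ (n%:Z - 1)) p k) /
  (qpoch (- (a * b)) p k * qpoch (a * c) p k * qpoch (a * d) p k) *
  (p ^+ k / qpoch p p k).

Definition awpoly n : {poly K} := \sum_(k < n.+1) awcoef n k *: awbasis k.

Lemma awbasis0 : awbasis 0 = 1.
Proof. by rewrite /awbasis big_ord0. Qed.

Lemma awbasisS k : awbasis k.+1 =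
  awbasis k * ((1 - (a * p ^+ k) ^+ 2)%:P + (a * p ^+ k) *: 'X).
Proof. by rewrite /awbasis big_ord_recr. Qed.

Lemma horner_awbasis k z : z != 0 ->
  (awbasis k).[z - z^-1] = qpoch (- (a * z)) p k * qpoch (a * z^-1) p k.
Proof.
move=> z0; elim: k => [|k IH]; first by rewrite awbasis0 !qpoch0 hornerC mulr1.
rewrite awbasisS hornerM IH !qpochS !hornerE /=.
by field.
Qed.

(** Gives [p] the shape of the regularity hypotheses, so that [qpoch_neq0] also covers the
    denominator (p;p)_k. *)
Lemma p_not_reg (j : nat) : p != p ^- j.
Proof.
apply: contra (p_pow j) => /eqP e; rewrite subr_eq0 exprSr {2}e mulfV //.
by rewrite expf_neq0.
Qed.

Lemma awcoef0 n : awcoef n 0 = 1.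
Proof. by rewrite /awcoef !qpoch0 !mulr1 !divr1 mulr1. Qed.

Lemma awcoef_vanish n k : (n < k)%N -> awcoef n k = 0.
Proof. by move=> nk; rewrite /awcoef qpoch_vanish // !mul0r. Qed.

Lemma awpoly_widen n m : (n <= m)%N ->
  awpoly n = \sum_(k < m.+1) awcoef n k *: awbasis k.
Proof.
move=> nm; rewrite /awpoly (big_ord_widen m.+1 (fun k => awcoef n k *: awbasis k)) //.
rewrite big_mkcond; apply: eq_bigr => k _; case: ltnP => // nk.
by rewrite awcoef_vanish // scale0r.
Qed.

Lemma awpoly_phi43 n z : z != 0 ->
  (awpoly n).[z - z^-1] =
  phi43 (p ^- n) (a * b * c * d * p ^ (n%:Z - 1)) (- (a * z)) (a * z^-1)
        (- (a * b)) (a * c) (a * d) p p.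
Proof.
move=> z0; rewrite /phi43 (@limn_series_finite _ _ n); last first.
  by move=> k nk; rewrite /phi43_term qpoch_vanish // !mul0r.
rewrite horner_sum; apply: eq_bigr => k _.
rewrite hornerZ horner_awbasis // /awcoef /phi43_term.
by ring.
Qed.

(** * Three-term recurrence in n *)

Lemma awcoefS n k :
  awcoef n k.+1 = awcoef n k *
    ((1 - p ^+ k * p ^- n) * (1 - p ^+ k * (a * b * c * d * p ^ (n%:Z - 1))) * p /
     ((1 + p ^+ k * (a * b)) * (1 - p ^+ k * (a * c)) * (1 - p ^+ k * (a * d)) *
      (1 - p ^+ k.+1))).
Proof.
rewrite /awcoef !qpochS exprSr mulrN opprK !invfM.
by ring.
Qed.

(** Every Pochhammer symbol that depends on n reduces to that of p^-(n+1) or abcd p^(n+1) of length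
    k; these are common to all terms, and an identity of rational functions remains. The two sides
    are the coefficients of e_(k+1) in the recurrence at index n+1. *)
Lemma awcoef_contiguous n k :
  awcoef n.+1 k / (a * p ^+ k)
  - (1 - (a * p ^+ k.+1) ^+ 2) / (a * p ^+ k.+1) * awcoef n.+1 k.+1 =
  recA p a b c d n.+1 * awcoef n.+2 k.+1
  + (a - a^-1 - recA p a b c d n.+1 - recC p a b c d n.+1) * awcoef n.+1 k.+1
  + recC p a b c d n.+1 * awcoef n k.+1.
Proof.
have eU1 : qpoch (p ^- n.+2) p k.+1 = (1 - p ^- n.+2) * qpoch (p ^- n.+1) p k.
  by rewrite qpochSl exprS invfM mulrA mulfV // mul1r.
have pn0 : p ^+ n != 0 by rewrite expf_neq0.
have pk0 : p ^+ k != 0 by rewrite expf_neq0.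
have n1 : 1 - p ^- n.+1 != 0.
  apply: contra (p_pow n); rewrite !subr_eq0 => /eqP e; apply/eqP.
  by rewrite -[p ^+ _]invrK -e invr1.
have eU0 : qpoch (p ^- n) p k.+1 = qpoch (p ^- n.+1) p k *
    (1 - p ^+ k * p ^- n.+1) * (1 - p ^+ k.+1 * p ^- n.+1) / (1 - p ^- n.+1).
  apply: (mulfI n1); rewrite mulrCA mulfV // mulr1 -!qpochS [RHS]qpochSl.
  by rewrite exprS invfM mulrA mulfV // mul1r.
(* The divisor met when the parameter abcd p^n is raised to abcd p^(n+1) at fixed length k. *)
have sk0 : 1 - p ^+ k * (a * b * c * d * p ^+ n) != 0.
  have := reg_neq0 (k + n) p_neq0 abcd_reg; rewrite exprD.
  by congr (_ != 0); ring.
set S := a * b * c * d.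
have eV1 : qpoch (S * p ^+ n) p k = 
    (1 - S * p ^+ n) * qpoch (S * p ^+ n.+1) p k / (1 - p ^+ k * (S * p ^+ n)).
  apply: (canRL (mulfK sk0)); rewrite -qpochS qpochSl; congr (_ * qpoch _ _ _).
  by rewrite exprS; ring.
have z1 : p ^ (n.+1%:Z - 1) = p ^+ n by rewrite -addn1 PoszD addrK.
have z2 : p ^ (n.+2%:Z - 1) = p ^+ n.+1 by rewrite -addn1 PoszD addrK.
(* A quotient, because the exponent is -1 when n = 0. *)
have z0 : p ^ (n%:Z - 1) = p ^+ n / p by rewrite expfzDr.
have z3 : p ^ (2 * n.+1%:Z - 1) = p ^+ n * p ^+ n * p.
  have -> : 2 * n.+1%:Z - 1 = (n + n).+1%:Z by lia.
  by rewrite -exprnP exprSr exprD.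
have z4 : p ^ (2 * n.+1%:Z) = p ^+ n * p ^+ n * p * p.
  have -> : 2 * n.+1%:Z = (n + n).+2%:Z by lia.
  by rewrite -exprnP !exprSr exprD.
have z5 : p ^ (2 * n.+1%:Z - 2) = p ^+ n * p ^+ n.
  have -> : 2 * n.+1%:Z - 2 = (n + n)%:Z by lia.
  by rewrite -exprnP exprD.
have eV0 : qpoch (S * (p ^+ n / p)) p k.+1 = (1 - S * (p ^+ n / p)) *
   ((1 - S * p ^+ n) * qpoch (S * p ^+ n.+1) p k / (1 - p ^+ k * (S * p ^+ n))).
  by rewrite qpochSl -eV1; congr (_ * qpoch _ _ _); field.
have eV2 : qpoch (S * p ^+ n) p k.+1 = (1 - S * p ^+ n) * qpoch (S * p ^+ n.+1) p k.
  by rewrite qpochSl; congr (_ * qpoch _ _ _); rewrite exprS; ring.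
have D1 := qpoch_neq0 k p_neq0 ab_reg.
have D2 := qpoch_neq0 k p_neq0 ac_reg.
have D3 := qpoch_neq0 k p_neq0 ad_reg.
have D4 := qpoch_neq0 k p_neq0 p_not_reg.
have h1 := reg_neq0 k p_neq0 ab_reg; have h2 := reg_neq0 k p_neq0 ac_reg.
have h3 := reg_neq0 k p_neq0 ad_reg.
have h4 := reg_neq0 (n + n) p_neq0 abcd_reg.
have h5 := reg_neq0 (n + n).+1 p_neq0 abcd_reg.
have h6 := reg_neq0 (n + n).+2 p_neq0 abcd_reg.
have h7 := p_pow n; have h8 := p_pow k.
rewrite /awcoef /recA /recC /= z0 z1 z2 z3 z4 z5 -/S eU1 eU0 eV0 eV2 eV1.
rewrite !qpochS /S {eU0 eU1 eV0 eV1 eV2 z0 z1 z2 z3 z4 z5 n1}.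
rewrite !exprSr in h7 h8 *; rewrite ?exprSr !exprD in h4 h5 h6.
(* From here p^n and p^k are independent indeterminates P and L: the identity does not use that they
   are powers of [p]. *)
move: pn0 pk0 sk0 h1 h2 h3 h4 h5 h6 h7 h8.
move: (p ^+ n) (p ^+ k) => P L pn0 pk0 sk0 h1 h2 h3 h4 h5 h6 h7 h8.
field.
rewrite D1 D2 D3 D4 h1 h2 h3 h8 p_neq0 pn0 pk0 sk0 a_neq0 /=.
rewrite -oppr_eq0 opprB h7 -(mulrC (P * P * p)) h5 -(mulrC (P * P)) h4.
by rewrite -(mulrC (P * P * p * p)) h6.
Qed.

Lemma fun_of_x_awbasis0 z : fun_of_x (awbasis 0) z = 1.
Proof. by rewrite /fun_of_x awbasis0 hornerC. Qed.

Lemma awpoly0 : awpoly 0 = 1.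
Proof. by rewrite /awpoly big_ord1 awcoef0 awbasis0 scale1r. Qed.

Lemma mulX_awbasis k : 'X * awbasis k =
  (a * p ^+ k)^-1 *: awbasis k.+1
  - ((1 - (a * p ^+ k) ^+ 2) / (a * p ^+ k)) *: awbasis k.
Proof.
have ap0 : a * p ^+ k != 0 by rewrite mulf_neq0 ?expf_neq0.
rewrite awbasisS mulrDr (mulrC _ _%:P) mul_polyC -scalerAr scalerDr !scalerA.
by rewrite mulVf // scale1r (mulrC _^-1) addrAC subrr add0r mulrC.
Qed.

(** Only e_0 and e_1 occur. The e_1 coefficients agree because A_0 times the top coefficient of
    [awpoly 1] is 1/a; the e_0 coefficients are then immediate. *)
Lemma awpoly_rec0 :
  'X * awpoly 0 = recA p a b c d 0 *: awpoly 1
    + (a - a^-1 - recA p a b c d 0) *: awpoly 0.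
Proof.
have h1 := reg_neq0 0 p_neq0 ab_reg; have h2 := reg_neq0 0 p_neq0 ac_reg.
have h3 := reg_neq0 0 p_neq0 ad_reg; have h4 := reg_neq0 0 p_neq0 abcd_reg.
have h5 := p_pow 0.
rewrite mulrN opprK in h1; rewrite !expr0 !mul1r expr1 in h1 h2 h3 h4 h5.
have hA : recA p a b c d 0 * awcoef 1 1 = a^-1.
  rewrite awcoefS awcoef0 /recA /= !expr0 !expr1 subrr expr0z.
  by field; rewrite p_neq0 a_neq0 h1 h2 h3 h4 h5.
rewrite awpoly0 /awpoly big_ord_recl big_ord1 /= !awcoef0 -awbasis0 mulX_awbasis.
rewrite expr0 mulr1 scale1r scalerDr scalerA hA addrAC -scalerDl addrC.
congr (_ + _); rewrite -scaleNr; congr (_ *: _).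
by field.
Qed.

Lemma awpoly_recS n :
  'X * awpoly n.+1 = recA p a b c d n.+1 *: awpoly n.+2
    + (a - a^-1 - recA p a b c d n.+1 - recC p a b c d n.+1) *: awpoly n.+1
    + recC p a b c d n.+1 *: awpoly n.
Proof.
set A := recA _ _ _ _ _ _; set C := recC _ _ _ _ _ _.
rewrite (awpoly_widen (ltnW (leqnSn n.+1))) (awpoly_widen (leqnSn n.+1)) /(awpoly n.+2).
apply/eqP; rewrite -subr_eq0; apply/eqP.
rewrite mulr_sumr !scaler_sumr -!big_split -sumrB /=.
pose T k := 'X * (awcoef n.+1 k *: awbasis k) -
  (A *: (awcoef n.+2 k *: awbasis k)
   + (a - a^-1 - A - C) *: (awcoef n.+1 k *: awbasis k)
   + C *: (awcoef n k *: awbasis k)).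
(* By [awcoef_contiguous] the e_(k+1) part of T (k+1) cancels what x e_k left over, so a partial sum
   retains only the e_(m+1) part of x e_m. *)
have tel m : \sum_(k < m.+1) T k = (awcoef n.+1 m / (a * p ^+ m)) *: awbasis m.+1.
  elim: m => [|m IH].
    (* The three recurrence coefficients add up to a - 1/a, which cancels the e_0 part of x e_0. *)
    rewrite big_ord1 /T !awcoef0 !scale1r mulX_awbasis -!scalerDl -addrA -opprD.
    rewrite -scalerDl expr0 mulr1 mul1r (_ : _ / a + _ = 0) ?scale0r ?subr0 //.
    by field.
  rewrite big_ord_recr IH /= (_ : T m.+1 = (awcoef n.+1 m.+1 / (a * p ^+ m.+1)) *:
      awbasis m.+2 - (awcoef n.+1 m / (a * p ^+ m)) *: awbasis m.+1).
    by rewrite addrC subrK.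
  rewrite /T -scalerAr mulX_awbasis scalerBr !scalerA -!scalerDl.
  rewrite -awcoef_contiguous -addrA -opprD -scalerDl.
  by congr (_ - _ *: _); ring.
by rewrite (tel n.+2) awcoef_vanish // mul0r scale0r.
Qed.

(** Needed to solve the recurrence for Q_(n+1). The regularity hypotheses exclude zeros of the
    denominator as well as of the numerator; either would make the quotient 0. *)
Lemma recA_neq0 n : recA p a b c d n != 0.
Proof.
have h1 := reg_neq0 n p_neq0 ab_reg; have h2 := reg_neq0 n p_neq0 ac_reg.
have h3 := reg_neq0 n p_neq0 ad_reg.
rewrite mulrN opprK in h1.
rewrite /recA; case: n h1 h2 h3 => [|n] h1 h2 h3 /=.
  have h4 := reg_neq0 0 p_neq0 abcd_reg; rewrite !expr0 !mul1r in h1 h2 h3 h4.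
  by rewrite mulf_neq0 ?oppr_eq0 ?invr_neq0 // ?mulf_neq0.
have z1 : p ^ (n.+1%:Z - 1) = p ^+ n by rewrite -addn1 PoszD addrK.
have z3 : p ^ (2 * n.+1%:Z - 1) = p ^+ (n + n).+1.
  by have -> : 2 * n.+1%:Z - 1 = (n + n).+1%:Z by lia.
have z4 : p ^ (2 * n.+1%:Z) = p ^+ (n + n).+2.
  by have -> : 2 * n.+1%:Z = (n + n).+2%:Z by lia.
rewrite z1 z3 z4 !(mulrC _ (p ^+ _)) mulf_neq0 ?invr_neq0 ?mulf_neq0 ?oppr_eq0 //;
  rewrite ?reg_neq0 // !mulf_neq0 ?reg_neq0 //.
Qed.

(** As A_n is nonzero, two consecutive values determine the next one; hence the induction on
    pairs. *)
Lemma awpoly_unique (Q : int -> {poly K}) :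
  Q 0 = 1 ->
  (forall n : nat,
    'X * Q n =
      recA p a b c d n *: Q (n%:Z + 1)
      + (a - a^-1 - recA p a b c d n - recC p a b c d n) *: Q n
      + recC p a b c d n *: Q (n%:Z - 1)) ->
  forall n : nat, Q n = awpoly n.
Proof.
move=> Q0 Qrec.
have Q1 : Q 1 = awpoly 1.
  have := Qrec 0%N; rewrite Q0 -awpoly0 awpoly_rec0.
  rewrite (_ : recC p a b c d 0 = 0) // scale0r subr0 addr0.
  by move/addIr/(scalerI (recA_neq0 0)) => <-.
suff H (n : nat) : Q n = awpoly n /\ Q n.+1 = awpoly n.+1 by move=> n; case: (H n).
elim: n => [|n [IH0 IH1]]; first by rewrite awpoly0.
split=> //; have := Qrec n.+1.
have -> : n.+1%:Z - 1 = n%:Z by lia.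
have -> : n.+1%:Z + 1 = n.+2%:Z by lia.
rewrite IH0 IH1 awpoly_recS.
by move/addIr/addIr/(scalerI (recA_neq0 _)) => <-.
Qed.

(** * Action of the operator on the basis, and the eigenvalue equation *)

Variable q : K.
Hypothesis p_def : p = - q.

Lemma q_def : q = - p. Proof. by rewrite p_def opprK. Qed.

Lemma q_neq0 : q != 0. Proof. by rewrite q_def oppr_eq0. Qed.

Lemma fun_of_x_awbasisS k z : z != 0 ->
  fun_of_x (awbasis k.+1) z =
  fun_of_x (awbasis k) z * (1 + a * z * p ^+ k) * (1 - a * z^-1 * p ^+ k).
Proof.
by move=> z0; rewrite /fun_of_x awbasisS hornerM !hornerE /=; field.
Qed.

(** Since q = -p, the substitution of 1/(qz) for z exchanges the two symbols of e_(k+1), turning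
    their parameters into a/(pz) and -apz. The factor 1 + az completes the symbol of -apz to that of
    -az with length k+2. *)
Lemma shift_awbasisS k z : z != 0 ->
  (1 + a * z) * shiftT q (invI (fun_of_x (awbasis k.+1))) z =
  fun_of_x (awbasis k) z * (1 - a / (p * z)) * (1 + a * z * p ^+ k)
    * (1 + a * z * p ^+ k.+1).
Proof.
move=> z0; have q0 := q_neq0; have qp := q_def.
rewrite /shiftT /invI /fun_of_x !horner_awbasis ?invr_eq0 ?mulf_neq0 // invrK.
have -> : - (a * (q * z)^-1) = a / (p * z) by rewrite qp; field; rewrite z0.
have -> : a * (q * z) = p * (- (a * z)) by rewrite qp; ring.
have -> : qpoch (a / (p * z)) p k.+1 = (1 - a / (p * z)) * qpoch (a * z^-1) p k.
  by rewrite qpochSl; congr (_ * qpoch _ _ _); field; rewrite z0.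
have e : (1 + a * z) * qpoch (p * - (a * z)) p k.+1 =
    qpoch (- (a * z)) p k * (1 + a * z * p ^+ k) * (1 + a * z * p ^+ k.+1).
  rewrite -{1}(opprK (a * z)) -qpochSl !qpochS.
  by ring.
by rewrite mulrCA e; ring.
Qed.

(* The factor [1 + a z] of [opB] turns the shifted basis element back into a
   multiple of [awbasis k]; the difference then has the factor
   [z + 1 / (p z)], which cancels [1 - q z^2] since [q = - p]. *)
Lemma opB_awbasisS k z : z != 0 -> 1 + z ^+ 2 != 0 -> 1 - q * z ^+ 2 != 0 ->
  opB q a b c d z * (shiftT q (invI (fun_of_x (awbasis k.+1))) z
                     - fun_of_x (awbasis k.+1) z) =
  - (a * (1 - p ^+ k.+1) * (1 + a * z * p ^+ k) * (1 + b * z) * (1 - c * z)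
     * (1 - d * z)) / (p * z * (1 + z ^+ 2)) * fun_of_x (awbasis k) z.
Proof.
move=> z0 h1 h2.
pose r := (1 + b * z) * (1 - c * z) * (1 - d * z)
          / ((1 + z ^+ 2) * (1 - q * z ^+ 2)).
transitivity (r * ((1 + a * z) * shiftT q (invI (fun_of_x (awbasis k.+1))) z
                   - (1 + a * z) * fun_of_x (awbasis k.+1) z)).
  by rewrite /opB /r; ring.
rewrite q_def in h2; rewrite shift_awbasisS // fun_of_x_awbasisS // /r q_def (exprSr p).
by field; rewrite z0 h1 p_neq0 h2.
Qed.

(** The symmetry of x that makes the second half of the operator the first half evaluated at
    -1/z. *)
Lemma fun_of_xVN (P : {poly K}) z : fun_of_x P (- z^-1) = fun_of_x P z.
Proof. by rewrite /fun_of_x invrN invrK opprK addrC. Qed.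

Lemma opD_awbasis0 z : opD q a b c d (fun_of_x (awbasis 0)) z = 0.
Proof.
by rewrite /opD /shiftT /invI !fun_of_x_awbasis0 !subrr !mulr0 addr0.
Qed.

(** Applying [opB_awbasisS] at z and at -1/z makes both halves multiples of e_k; in their sum the
    denominator 1 + z^2 cancels. *)
Lemma opD_awbasisS k z : regular_point q z ->
  opD q a b c d (fun_of_x (awbasis k.+1)) z =
  p ^- k.+1 * (1 - p ^+ k.+1) * (1 - a * b * c * d * p ^+ k)
    * fun_of_x (awbasis k.+1) z
  - p ^- k.+1 * (1 - p ^+ k.+1) * (1 + p ^+ k * (a * b)) * (1 - p ^+ k * (a * c))
    * (1 - p ^+ k * (a * d)) * fun_of_x (awbasis k) z.
Proof.
case=> z0; rewrite !mulf_eq0 !negb_or => /andP[h1 h2] /andP[h3 h4].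
have pk0 : p ^+ k != 0 by rewrite expf_neq0.
have zi0 : - z^-1 != 0 by rewrite oppr_eq0 invr_eq0.
have es : shiftT q^-1 (invI (fun_of_x (awbasis k.+1))) z =
    shiftT q (invI (fun_of_x (awbasis k.+1))) (- z^-1).
  rewrite /shiftT /invI mulrN invrN !invfM !invrK.
  by rewrite -(fun_of_xVN _ (- _)) invrN opprK invfM invrK.
have := opB_awbasisS k zi0 h3 h4; rewrite !fun_of_xVN /opD es => ->.
rewrite opB_awbasisS // fun_of_x_awbasisS // !(exprSr p).
by field; rewrite p_neq0 pk0 z0 addrC h1.
Qed.

Lemma opD_sum n (u : nat -> K) z :
  opD q a b c d (fun_of_x (\sum_(k < n) u k *: awbasis k)) z =
  \sum_(k < n) u k * opD q a b c d (fun_of_x (awbasis k)) z.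
Proof.
rewrite /opD /shiftT /invI /fun_of_x !horner_sum -!sumrB !mulr_sumr -big_split.
by apply: eq_bigr => k _ /=; rewrite !hornerZ; ring.
Qed.

Definition aweigen n : K :=
  p ^- n * (1 - p ^+ n) * (1 - a * b * c * d * p ^ (n%:Z - 1)).

Lemma opD_awpoly n z : regular_point q z ->
  opD q a b c d (fun_of_x (awpoly n)) z = aweigen n * fun_of_x (awpoly n) z.
Proof.
move=> zreg; apply/eqP; rewrite -subr_eq0; apply/eqP.
rewrite /awpoly opD_sum {2}/fun_of_x horner_sum mulr_sumr -sumrB.
under eq_bigr => k _ do rewrite hornerZ -/(fun_of_x (awbasis k) z).
pose T k := awcoef n k * opD q a b c d (fun_of_x (awbasis k)) z
  - aweigen n * (awcoef n k * fun_of_x (awbasis k) z).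
(* With eigenvalues l_k, the difference l_k - l_n factors as p^-k (1 - p^(k-n)) (1 - abcd
   p^(k+n-1)). These are the numerator factors of the term ratio [awcoefS], so the e_k part of T k
   cancels against T (k+1); at m = n the remainder has the factor l_n - l_n. *)
have tel m : \sum_(k < m.+1) T k =
    - (awcoef n m * (aweigen n - aweigen m) * fun_of_x (awbasis m) z).
  elim: m => [|m IH].
    rewrite big_ord1 /T opD_awbasis0 awcoef0 /aweigen expr0 subrr.
    by ring.
  have h1 := reg_neq0 m p_neq0 ab_reg; have h2 := reg_neq0 m p_neq0 ac_reg.
  have h3 := reg_neq0 m p_neq0 ad_reg; have h4 := p_pow m.
  have pn0 : p ^+ n != 0 by rewrite expf_neq0.
  have pm0 : p ^+ m != 0 by rewrite expf_neq0.
  rewrite mulrN opprK in h1.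
  have zm : p ^ (m.+1%:Z - 1) = p ^+ m by rewrite -addn1 PoszD addrK.
  rewrite big_ord_recr /= IH /T opD_awbasisS // awcoefS /aweigen zm.
  rewrite !expfzDr // -!exprnP !exprN1 !(exprSr p) in h4 *.
  by field; rewrite p_neq0 pn0 pm0 h1 h2 h3 h4.
by rewrite (tel n) subrr mulr0 mul0r oppr0.
Qed.

End Expansion.

Theorem mainTheorem4 (R : realType) (q : R) (q_gt0 : 0 < q) (q_lt1 : q < 1)
  (p : R[i]) (p_def : p = - q%:C%C)
  (a b c d : R[i]) (a_neq0 : a != 0) (b_neq0 : b != 0)
  (c_neq0 : c != 0) (d_neq0 : d != 0)
  (ab_reg : forall k : nat, - (a * b) != p ^- k)
  (ac_reg : forall k : nat, a * c != p ^- k)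
  (ad_reg : forall k : nat, a * d != p ^- k)
  (abcd_reg : forall k : nat, a * b * c * d != p ^- k)
  (Q : int -> {poly R[i]})
  (Q_m1 : Q (-1) = 0) (Q_0 : Q 0 = 1)
  (Q_rec : forall n : nat,
    'X * Q n =
      recA p a b c d n *: Q (n%:Z + 1)
      + (a - a^-1 - recA p a b c d n - recC p a b c d n) *: Q n
      + recC p a b c d n *: Q (n%:Z - 1)) :
  forall n : nat,
    (forall z : R[i], z != 0 ->
       (Q n).[z - z^-1] =
       phi43 (p ^- n) (a * b * c * d * p ^ (n%:Z - 1)) (- (a * z)) (a * z^-1)
             (- (a * b)) (a * c) (a * d) p p)
    /\
    (forall z : R[i], regular_point q%:C%C z ->
       opD q%:C%C a b c d (fun_of_x (Q n)) z =
       (p ^- n * (1 - p ^+ n) * (1 - a * b * c * d * p ^ (n%:Z - 1)))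
         * fun_of_x (Q n) z).
Proof.
have normp : `|p| = q%:C%C by rewrite p_def normrN normc_def /= expr0n addr0 sqrtr_sqr gtr0_norm.
have p_neq0 : p != 0 by rewrite -normr_gt0 normp ltcR.
(* As |p| = q < 1, [p] is not a root of unity. *)
have p_pow k : 1 - p ^+ k.+1 != 0.
  rewrite subr_eq0; apply/eqP => /(congr1 (fun x => `|x|)) /eqP.
  rewrite normr1 normrX normp eq_sym lt_eqF //.
  by rewrite exprn_ilt1 // ?lecR ?ltcR // ltW.
move=> n.
rewrite (awpoly_unique p_neq0 p_pow a_neq0 ab_reg ac_reg ad_reg abcd_reg Q_0 Q_rec).
split=> z hz; first exact: awpoly_phi43.
exact: opD_awpoly.
Qed.
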